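(* Let $\phi:\mathbb{R}\to\mathbb{R}$ be smooth, let $f:\mathbb{R}\to\mathbb{R}$ be the noisy function $f(t)=\phi(t)+\epsilon(t)$ with $\epsilon:\mathbb{R}\to\mathbb{R}$, let $\epsilon_f>0$, and let $r_S$ be a testing ratio as defined in the context. Let $t\in\mathbb{R}$ be the point at which the procedure is run, $h_0$ the initial interval and $\eta>1$ the scaling factor. Suppose that: (i) $\left|r_S(h;\phi,\tau,\epsilon_f)-r_S(h;f,\tau,\epsilon_f)\right|\le 1$ for all $\tau\in\mathbb{R}$ and all $h>0$; (ii) $r_S(h;\phi,t,\epsilon_f)$ is continuous (as a function of $h$) with $r_S(0;\phi,t,\epsilon_f)=0$, and there exists an integer $K\in\mathbb{N}$ such that $r_S(2^K h_0;\phi,t,\epsilon_f)\ge r_u-1$; (iii) the finite-difference interval $h$ satisfies $h\ge 0$ (in particular $h_0\ge 0$); (iv) $r_l$ and $r_u$ are chosen such that $0<r_l<r_u-2$. Then the Adaptive Finite-Difference Interval Estimation algorithm (described in the context), run with inputs $f,t,\epsilon_f,r_S,r_l,r_u,h_0,\eta$, terminates successfully in a finite number of iterations, i.e. after finitely many iterations it returns an $h$ with $r_S(h;f,t,\epsilon_f)\in[r_l,r_u]$.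
   Context: **Testing ratio.** Let $d\ge 1$ be the order of the derivative being approximated by a finite-difference scheme $S$ and let $q\ge d+1$ be the integer order of the remainder term in the Taylor expansion of that scheme. A testing ratio associated with $S$ is given by an integer $\tilde m\ge q+1$ and vectors $\tilde w,\tilde s\in\mathbb{R}^{\tilde m}$ with $\tilde s_j\neq\tilde s_k$ for all $j\ne k$, $\|\tilde w\|_1=\sum_j|\tilde w_j|=1$, and such that $$\sum_{j=1}^{\tilde m}\tilde w_j\,\phi(t+h\tilde s_j)=c_r\,\phi^{(q)}(t)\,h^q+o(h^q),\qquad c_r=\frac{1}{q!}\sum_{j=1}^{\tilde m}\tilde w_j\tilde s_j^{\,q}\neq 0,$$ as $h\to 0$. For a function $g:\mathbb{R}\to\mathbb{R}$ (used with $g=f$ and $g=\phi$), the testing ratio is $$r_S(h;g,t,\epsilon_f)=\frac{\left|\sum_{j=1}^{\tilde m}\tilde w_j\,g(t+h\tilde s_j)\right|}{\epsilon_f}.$$ **Adaptive Finite-Difference Interval Estimation algorithm.** Inputs: one-dimensional noisy function $f$, point $t$, noise level $\epsilon_f>0$, testing ratio $r_S$ for the scheme $S$, lower and upper bounds $r_l,r_u$, initial interval $h_0$, scaling factor $\eta>1$. Output: an interval $h$ such that $r_S(h;f,t,\epsilon_f)\in[r_l,r_u]$. Initialize $h\leftarrow h_0$, $l\leftarrow 0$, $u\leftarrow+\infty$. Repeat the following iteration: 1. Evaluate $r_S(h;f,t,\epsilon_f)$. 2. If $r_S(h;f,t,\epsilon_f)<r_l$, set $l\leftarrow h$; else if $r_S(h;f,t,\epsilon_f)>r_u$,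 set $u\leftarrow h$; otherwise stop and return $h$. 3. If $u=+\infty$, set $h\leftarrow\eta h$; else if $l=0$, set $h\leftarrow h/\eta$; else set $h\leftarrow(l+u)/2$.
   Formalization: In hypothesis (ii) the condition is r_S(η^K h_0; φ, t, ε_f) ≥ r_u − 1 with the scaling factor η in place of 2; with 2^K and general η > 1 the claim is false (e.g. η = 3, φ(x) = 3cos(πx/2), second-difference ratio), and for η = 2 the two agree. *)

(* Defs.v *)
From HB Require Import structures.
From mathcomp Require Import all_boot all_order all_algebra.
From mathcomp Require Import all_classical all_reals all_analysis.

Set Implicit Arguments.
Unset Strict Implicit.
Unset Printing Implicit Defensive.

Import Order.TTheory GRing.Theory Num.Theory.
Import numFieldNormedType.Exports.

Local Open Scope classical_set_scope.
Local Open Scope ring_scope.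

Definition smooth (R : realType) (phi : R -> R) : Prop :=
  forall (n : nat) (x : R), derivable (phi^`(n))%classic x 1.

Definition fd_sum (R : realType) (m : nat) (w s : 'rV[R]_m) (g : R -> R)
    (t h : R) : R :=
  \sum_(j < m) w 0 j * g (t + h * s 0 j).

Definition testing_coef (R : realType) (q m : nat) (w s : 'rV[R]_m) : R :=
  (q`!%:R)^-1 * \sum_(j < m) w 0 j * s 0 j ^+ q.

(* The scheme being tested enters only through the order [d] of the derivative
   it approximates and the order [q] of its Taylor remainder.  The expansion is
   required for the given function [phi], at every point. *)
Record is_testing_scheme (R : realType) (phi : R -> R) (d q m : nat)
    (w s : 'rV[R]_m) : Prop := IsTestingScheme {
  testing_d_gt0 : (1 <= d)%N ;
  testing_q_ge : (d + 1 <= q)%N ;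
  testing_m_ge : (q + 1 <= m)%N ;
  testing_shifts_neq : forall j k : 'I_m, j != k -> s 0 j != s 0 k ;
  testing_weights_norm1 : \sum_(j < m) `|w 0 j| = 1 ;
  testing_coef_neq0 : testing_coef q w s != 0 ;
  testing_expansion : forall t : R,
    (fun h : R =>
       fd_sum w s phi t h - testing_coef q w s * (phi^`(q))%classic t * h ^+ q)
      =o_ ((0 : R)^') (fun h : R => h ^+ q)
}.

Definition testing_ratio (R : realType) (m : nat) (w s : 'rV[R]_m)
    (h : R) (g : R -> R) (t eps_f : R) : R :=
  `|fd_sum w s g t h| / eps_f.

Record afd_state (R : realType) := AfdState {
  afd_h : R ;
  afd_l : R ;
  afd_u : \bar R
}.

Definition afd_init (R : realType) (h0 : R) : afd_state R :=
  AfdState h0 0 +oo%E.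

(* Step 3.  [fine] is only applied to a finite upper end. *)
Definition afd_update (R : realType) (eta h l : R) (u : \bar R) : afd_state R :=
  AfdState
    (if u == +oo%E then eta * h
     else if l == 0 then h / eta
     else (l + fine u) / 2)
    l u.

(* One iteration, for the ratio [r : h |-> r_S(h; f, t, eps_f)]: [inl] is the
   state for the next iteration, [inr h] means "stop and return h". *)
Definition afd_step (R : realType) (r : R -> R) (rl ru eta : R)
    (st : afd_state R) : afd_state R + R :=
  let: AfdState h l u := st in
  if r h < rl then inl (afd_update eta h h u)
  else if ru < r h then inl (afd_update eta h l h%:E)
  else inr h.

(* At most [n] iterations; [None] if the loop has not stopped by then. *)
Fixpoint afd_iter (R : realType) (r : R -> R) (rl ru eta : R) (n : nat)
    (st : afd_state R) : option R :=
  if n is n'.+1 then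
    match afd_step r rl ru eta st with
    | inl st' => afd_iter r rl ru eta n' st'
    | inr h => Some h
    end
  else None.

Definition adaptive_fd (R : realType) (m : nat) (f : R -> R) (t eps_f : R)
    (w s : 'rV[R]_m) (rl ru h0 eta : R) (n : nat) : option R :=
  afd_iter (fun h => testing_ratio w s h f t eps_f) rl ru eta n (afd_init h0).

(* Main.v *)
(** Write [g] for the ratio of [phi] and [r] for that of [f].  The noise bound
    turns [r h < rl] into [g h < a] and [ru < r h] into [b < g h], where
    [a = rl + 1 < b = ru - 1].  Expansion cannot go past [eta ^+ K * h0], where
    [b <= g]; shrinking cannot go on because [g] is continuous with [g 0 < b];
    and bisection keeps a bracket with [g l < a] and [b < g u], which is
    impossible once [u - l] is below a modulus of uniform continuity of [g]
    for [b - a]. *)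
Require Import Defs.
From HB Require Import structures.
From mathcomp Require Import all_boot all_order all_algebra.
From mathcomp Require Import all_classical all_reals all_analysis.
From mathcomp Require Import lra.

Set Implicit Arguments.
Unset Strict Implicit.
Unset Printing Implicit Defensive.

Import Order.TTheory GRing.Theory Num.Theory.
Import numFieldNormedType.Exports.

Local Open Scope classical_set_scope.
Local Open Scope ring_scope.

(** Halving both [e] and the radius of continuity at [x] makes one [dlt] serve all points near [x];
    compactness, in near-covering form, merges these into one [dlt] for [K]. Only [x] is confined to
    [K], so [K] may be a single point. *)
Lemma compact_uniform_continuity (R : realType) (g : R -> R) (K : set R)
    (e : R) :
  continuous g -> compact K -> 0 < e ->
  exists2 delta, 0 < delta &
    forall x y, K x -> `|x - y| < delta -> `|g x - g y| < e.
Proof.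
move=> gc /compact_near_coveringP cK e0.
pose P (dlt x : R) := forall y, `|x - y| < dlt -> `|g x - g y| < e.
have /cK : forall x, K x ->
    \forall x' \near x & dlt \near (0 : R)^'+, P dlt x'.
  move=> x _; have e2 : 0 < e / 2 by rewrite divr_gt0.
  have /cvgrPdist_lt/(_ _ e2)/nbhs_ballP[r /= r0 gr] := gc x.
  have r2 : 0 < r / 2 by rewrite divr_gt0.
  exists (ball x (r / 2), [set dlt | dlt < r / 2]) => /=.
    by split; [exact: nbhsx_ballx|exact: nbhs_right_lt].
  move=> [x' dlt] /= [xx' dr] y x'y.
  have gx' : `|g x - g x'| < e / 2.
    by apply: gr; apply: le_ball xx'; lra.
  have gy : `|g x - g y| < e / 2.
    apply: gr; rewrite /ball /=; rewrite /ball /= in xx'.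
    have := ler_distD x' x y; lra.
  have := ler_distD (g x) (g x') (g y).
  by rewrite (distrC (g x') (g x)); lra.
move=> nearP.
have [dlt [Pd d0]] : exists dlt, (K `<=` P dlt) /\ 0 < dlt.
  apply: (@filter_ex _ (0 : R)^'+); apply: filterI => //.
  exact: nbhs_right_gt.
by exists dlt => // x y Kx; exact: Pd.
Qed.

Definition afd_halts (R : realType) (r : R -> R) (rl ru eta : R)
    (st : afd_state R) : Prop :=
  exists n h, afd_iter r rl ru eta n st = Some h.

Lemma afd_halts_step (R : realType) (r : R -> R) (rl ru eta : R)
    (st : afd_state R) :
  (forall st', afd_step r rl ru eta st = inl st' ->
     afd_halts r rl ru eta st') ->
  afd_halts r rl ru eta st.
Proof.
move=> H; case E: (afd_step r rl ru eta st) => [st'|h].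
  by have [n [h nh]] := H _ E; exists n.+1, h; rewrite /= E.
by exists 1%N, h; rewrite /= E.
Qed.

(** A value is returned only when both comparisons fail, so correctness is independent of
    termination. *)
Lemma afd_iter_Some (R : realType) (r : R -> R) (rl ru eta : R) (n : nat)
    (st : afd_state R) (h : R) :
  afd_iter r rl ru eta n st = Some h -> rl <= r h <= ru.
Proof.
elim: n st => [//|n IH] [h' l u] /=.
case: ltP => [_|rlh]; first exact: IH.
case: ltP => [_|rhu]; first exact: IH.
by case=> <-; rewrite rlh.
Qed.

Lemma afd_halts_bisection (R : realType) (r g : R -> R) (rl ru eta a b l u : R) :
  continuous g -> a < b ->
  (forall h, 0 < h -> r h < rl -> g h < a) ->
  (forall h, 0 < h -> ru < r h -> b < g h) ->
  0 < l -> l < u -> r l < rl -> ru < r u ->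
  afd_halts r rl ru eta (AfdState ((l + u) / 2) l u%:E).
Proof.
move=> gc ab ga gb l0.
have ba0 : 0 < b - a by rewrite subr_gt0.
have [dlt d0 gd] := compact_uniform_continuity gc (@segment_compact _ l u) ba0.
move=> lu rl_l ru_u.
(* [n] bounds the number of halvings needed to bring the width below [dlt]. *)
have [n] : exists n, u - l < dlt * 2 ^+ n.
  exists (Num.bound ((u - l) / dlt)).
  by rewrite mulrC -ltr_pdivrMr// upper_nthrootP.
(* Sub-brackets stay inside [[l, u]], so the same [dlt] serves throughout the induction. *)
have bracket k : forall l' u', l <= l' -> l' < u' -> u' <= u ->
    r l' < rl -> ru < r u' -> u' - l' < dlt * 2 ^+ k ->
    afd_halts r rl ru eta (AfdState ((l' + u') / 2) l' u'%:E); last first.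
  by apply: bracket.
elim: k => [|k IH] l' u' ll' l'u' u'u rl_l' ru_u'.
  rewrite expr0 mulr1 => small.
  have := gd l' u'; rewrite /= in_itv /= ll' (ltW (lt_le_trans l'u' u'u)) => /(_ isT).
  rewrite distrC gtr0_norm ?subr_gt0// => /(_ small).
  (* Contradiction: [g] rises by more than [b - a] over a width below [dlt]. *)
  have gu' : b < g u' by apply: gb => //; lra.
  have gl' : g l' < a by apply: ga => //; lra.
  by rewrite distrC; have := ler_norm (g u' - g l'); lra.
rewrite exprS => small.
have small' : (u' - l') / 2 < dlt * 2 ^+ k by lra.
apply: afd_halts_step => st' /=.
(* Whichever end moves, the new lower end is nonzero, so the update bisects again. *)
have l'N0 : l' == 0 = false by apply/eqP; lra.
have mN0 : (l' + u') / 2 == 0 = false by apply/eqP; lra.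
case: ltP => [rm|_]; last case: ltP => [rm|//].
  case=> <-; rewrite /afd_update /= mN0; apply: IH => //; lra.
case=> <-; rewrite /afd_update /= l'N0; apply: IH => //; lra.
Qed.

(** While the lower end is 0, each too-large verdict divides [h] by [eta]; near 0, where [g < b],
    that verdict is impossible. A too-small verdict makes [h] a positive lower end and hands over to
    bisection. *)
Lemma afd_halts_shrinking (R : realType) (r g : R -> R)
    (rl ru eta a b h u : R) :
  continuous g -> a < b -> g 0 < b -> 1 < eta ->
  (forall h, 0 < h -> r h < rl -> g h < a) ->
  (forall h, 0 < h -> ru < r h -> b < g h) ->
  0 < h -> h < u -> ru < r u ->
  afd_halts r rl ru eta (AfdState h 0 u%:E).
Proof.
move=> gc ab g0b eta1 ga gb h0 hu ru_u.
have eta0 : 0 < eta by lra.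
have [e /= e0 ge] : exists2 e, 0 < e & forall x, `|x| < e -> g x < b.
  (* Continuity at 0 with tolerance [b - g 0], read off from the compact set [{0}]. *)
  have [e e0 ge] := compact_uniform_continuity gc (@compact_set1 _ (0 : R))
    (eqbRL (subr_gt0 _ _) g0b).
  exists e => // x xe; have := ge 0 x erefl.
  rewrite sub0r normrN => /(_ xe).
  by rewrite distrC; have := ler_norm (g x - g 0); lra.
have [n] : exists n, h * eta^-1 ^+ n < e.
  have /cvgrPdist_lt/(_ _ e0)[n _ /(_ n (leqnn n))] :
      h * eta^-1 ^+ n @[n --> \oo] --> (0 : R).
    apply: cvg_geometric.
    by rewrite gtr0_norm ?invr_gt0// invf_lt1.
  rewrite /= sub0r normrN gtr0_norm ?mulr_gt0 ?exprn_gt0 ?invr_gt0//.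
  by exists n.
elim: n h u h0 hu ru_u => [|n IH] h u h0 hu ru_u; last rewrite exprS mulrA.
  rewrite expr0 mulr1 => small; apply: afd_halts_step => st' /=.
  case: ltP => [rh|_].
    case=> <-; rewrite /afd_update /= (gt_eqF h0).
    exact: (afd_halts_bisection eta gc ab ga gb).
  case: ltP => [rh _|//].
  by have := gb h h0 rh; have := ge h; rewrite gtr0_norm// => /(_ small); lra.
move=> small; apply: afd_halts_step => st' /=.
case: ltP => [rh|_].
  case=> <-; rewrite /afd_update /= (gt_eqF h0).
  exact: (afd_halts_bisection eta gc ab ga gb).
case: ltP => [rh|//] [<-]; rewrite /afd_update /= eqxx.
by apply: IH; rewrite ?divr_gt0// ltr_pdivrMr// ltr_pMr.
Qed.

(** [k] counts the enlargements left before reaching a point where [b <= g]. The disjunction on [l]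
    separates the initial state from those where an earlier interval was found too small. *)
Lemma afd_halts_expansion (R : realType) (r g : R -> R)
    (rl ru eta a b h l : R) (k : nat) :
  continuous g -> a < b -> g 0 < b -> 1 < eta ->
  (forall h, 0 < h -> r h < rl -> g h < a) ->
  (forall h, 0 < h -> ru < r h -> b < g h) ->
  0 < h -> b <= g (eta ^+ k * h) ->
  l = 0 \/ [/\ 0 < l, l < h & r l < rl] ->
  afd_halts r rl ru eta (AfdState h l +oo%E).
Proof.
move=> gc ab g0b eta1 ga gb.
have eta0 : 0 < eta by lra.
(* The first finite upper end ends expansion: shrinking follows if [l' = 0], bisection otherwise. *)
have stepu h' l' : 0 < h' -> ru < r h' ->
    l' = 0 \/ [/\ 0 < l', l' < h' & r l' < rl] ->
    afd_halts r rl ru eta (afd_update eta h' l' h'%:E).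
  move=> h'0 ruh'; rewrite /afd_update /= => -[->|[l'0 l'h' rl']].
    rewrite eqxx; apply: (afd_halts_shrinking gc ab g0b) => //.
      by rewrite divr_gt0.
    by rewrite ltr_pdivrMr// ltr_pMr.
  by rewrite (gt_eqF l'0); exact: (afd_halts_bisection eta gc ab ga gb).
elim: k h l => [|k IH] h l h0 gh lP; apply: afd_halts_step => st' /=.
  case: ltP => [rh _|_]; last by case: ltP => [rh [<-]|//]; exact: stepu.
  (* With no enlargement left, [b <= g h] contradicts [g h < a]. *)
  by rewrite mul1r in gh; have := ga h h0 rh; lra.
case: ltP => [rh [<-]|_]; last by case: ltP => [rh [<-]|//]; exact: stepu.
rewrite /afd_update /=; apply: IH; first exact: mulr_gt0.
  by rewrite mulrA -exprSr.
by right; split=> //; rewrite ltr_pMl.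
Qed.

Theorem theorem3p4 (R : realType) (phi noise f : R -> R) (eps_f : R)
    (d q m : nat) (w s : 'rV[R]_m) (t h0 eta rl ru : R)
    (phi_smooth : smooth phi)
    (f_def : forall x : R, f x = phi x + noise x)
    (eps_f_gt0 : 0 < eps_f)
    (rS_testing : is_testing_scheme phi d q w s)
    (eta_gt1 : 1 < eta)
    (ratio_noise : forall tau h : R, 0 < h ->
      `|testing_ratio w s h phi tau eps_f
        - testing_ratio w s h f tau eps_f| <= 1)
    (ratio_continuous :
      continuous (fun h : R => testing_ratio w s h phi t eps_f))
    (ratio_at0 : testing_ratio w s 0 phi t eps_f = 0)
    (ratio_large : exists K : nat,
      ru - 1 <= testing_ratio w s (eta ^+ K * h0) phi t eps_f)
    (h0_ge0 : 0 <= h0)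
    (rl_gt0 : 0 < rl)
    (rl_lt_ru : rl < ru - 2) :
  exists (n : nat) (h : R),
    adaptive_fd f t eps_f w s rl ru h0 eta n = Some h /\
    rl <= testing_ratio w s h f t eps_f <= ru.
Proof.
set r := fun h => testing_ratio w s h f t eps_f.
set g := fun h => testing_ratio w s h phi t eps_f.
have ga h : 0 < h -> r h < rl -> g h < rl + 1.
  move=> /(ratio_noise t); rewrite -/(r h) -/(g h) ler_norml; lra.
have gb h : 0 < h -> ru < r h -> ru - 1 < g h.
  move=> /(ratio_noise t); rewrite -/(r h) -/(g h) ler_norml; lra.
have ab : rl + 1 < ru - 1 by lra.
have g0b : g 0 < ru - 1 by rewrite /g ratio_at0; lra.
have [K gK] := ratio_large.
(* If [h0] were 0, all its multiples would be 0, and [gK] would contradict [g 0 < ru - 1]. *)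
have h0_gt0 : 0 < h0.
  rewrite lt_neqAle h0_ge0 andbT; apply: contraTN g0b => /eqP h00.
  by rewrite -leNgt; move: gK; rewrite -h00 mulr0.
have [n [h nh]] : afd_halts r rl ru eta (afd_init h0).
  by apply: (afd_halts_expansion ratio_continuous ab g0b eta_gt1 ga gb h0_gt0 gK);
    left.
by exists n, h; split=> //; exact: afd_iter_Some nh.
Qed.
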